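(* Let $m,n\ge 2$ be integers and let $\mathcal{A}$ be a real $m$th order $n$-dimensional circulant tensor with associated tensor $\bar{\mathcal{A}}_1$ and first native eigenvalue $\lambda_0(\mathcal{A})$. If $\bar{\mathcal{A}}_1$ is a nonnegative tensor (all entries $\ge 0$), then $\lambda_0(\mathcal{A})$ is the largest H-eigenvalue of $\mathcal{A}$. If $\bar{\mathcal{A}}_1$ is a non-positive tensor (all entries $\le 0$), then $\lambda_0(\mathcal{A})$ is the smallest H-eigenvalue of $\mathcal{A}$.
   Context: Write $[n]=\{1,\dots,n\}$. A real $m$th order $n$-dimensional tensor is an array $\mathcal{A}=(a_{j_1\cdots j_m})$ of real numbers indexed by $[n]^m$. It is circulant if $a_{j_1\cdots j_m}=a_{k_1\cdots k_m}$ whenever $j_l,k_l\in[n]$ and $k_l\equiv j_l+1 \pmod n$ for all $l\in[m]$. The root tensor of a circulant tensor $\mathcal{A}$ is the order $m-1$ tensor $\mathcal{A}_1=(\alpha_{j_1\cdots j_{m-1}})$ with $\alpha_{j_1\cdots j_{m-1}}=a_{1j_1\cdots j_{m-1}}$. The associated tensor $\bar{\mathcal{A}}_1$ is obtained from $\mathcal{A}_1$ by replacing the entry $\alpha_{1\cdots1}$ by $0$ and keeping all other entries. The first native eigenvalue is $\lambda_0(\mathcal{A})=\sum_{j_1,\dots,j_{m-1}=1}^n\alpha_{j_1\cdots j_{m-1}}$. A real number $\lambda$ is an H-eigenvalue of $\mathcal{A}$ if there is $\mathbf{x}\in\mathbb{R}^n\setminus\{\mathbf{0}\}$ with $\sum_{j_2,\dots,j_m=1}^n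 a_{jj_2\cdots j_m}x_{j_2}\cdots x_{j_m}=\lambda x_j^{m-1}$ for all $j\in[n]$. *)

(* Defs.v *)
From mathcomp Require Import all_boot all_order all_algebra.
From mathcomp Require Import reals.

Set Implicit Arguments.
Unset Strict Implicit.
Unset Printing Implicit Defensive.

Import Order.TTheory GRing.Theory Num.Theory.
Local Open Scope ring_scope.

(* The index set {1, ..., n} is rendered by 'I_n, with [i : 'I_n] standing for
   the 1-based index i + 1; in particular the index 1 is [ord0]. *)
Definition tensor (R : realType) (m n : nat) : Type := m.-tuple 'I_n -> R.

Definition circulant (R : realType) (m n : nat) (A : tensor R m n) : Prop :=
  forall j k : m.-tuple 'I_n,
    (forall l : 'I_m, tnth k l = tnth j l + 1 %[mod n])%N -> A j = A k.

Definition root_tensor (R : realType) (m n : nat) (A : tensor R m.+1 n.+1) :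
    tensor R m n.+1 :=
  fun j => A (cons_tuple ord0 j).

Definition associated_tensor (R : realType) (m n : nat)
    (A : tensor R m.+1 n.+1) : tensor R m n.+1 :=
  fun j => if j == nseq_tuple m ord0 then 0 else root_tensor A j.

Definition native_eigenvalue0 (R : realType) (m n : nat)
    (A : tensor R m.+1 n.+1) : R :=
  \sum_(j : m.-tuple 'I_n.+1) root_tensor A j.

Definition nonnegative_tensor (R : realType) (m n : nat) (A : tensor R m n) :
    Prop :=
  forall j, 0 <= A j.

Definition nonpositive_tensor (R : realType) (m n : nat) (A : tensor R m n) :
    Prop :=
  forall j, A j <= 0.

(* [A] has order m + 1, so the exponent (order - 1) is m. *)
Definition H_eigenvalue (R : realType) (m n : nat) (A : tensor R m.+1 n)
    (lambda : R) : Prop :=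
  exists2 x : 'cV[R]_n, x != 0 &
    forall j : 'I_n,
      \sum_(s : m.-tuple 'I_n)
        A (cons_tuple j s) * \prod_(l < m) x (tnth s l) 0
      = lambda * x j 0 ^+ m.

Definition largest_H_eigenvalue (R : realType) (m n : nat)
    (A : tensor R m.+1 n) (lambda : R) : Prop :=
  H_eigenvalue A lambda /\ forall mu : R, H_eigenvalue A mu -> mu <= lambda.

Definition smallest_H_eigenvalue (R : realType) (m n : nat)
    (A : tensor R m.+1 n) (lambda : R) : Prop :=
  H_eigenvalue A lambda /\ forall mu : R, H_eigenvalue A mu -> lambda <= mu.

(* Main.v *)
(* The cyclic shift of indices carries each row of a circulant tensor onto the
   next one, so every row sums to lambda_0, and (1, ..., 1) is an eigenvector
   for lambda_0.  If (mu, x) is another eigenpair and |x_i| is maximal, then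
     (lambda_0 - mu) x_i^(2m) = sum_s a_(i,s) (x_i^m x_i^m - x_i^m x_s),
   where x_s is the product of the x_(s_l).  The bracket is nonnegative, and it
   vanishes at s = (i, ..., i), the only place where the sign of a_(i,s) is
   unknown; hence mu <= lambda_0.  The non-positive case is the nonnegative one
   for -A. *)
Require Import Defs.
From mathcomp Require Import all_boot all_order all_algebra.
From mathcomp Require Import reals.

Set Implicit Arguments.
Unset Strict Implicit.
Unset Printing Implicit Defensive.

Import Order.TTheory GRing.Theory Num.Theory.
Local Open Scope ring_scope.

Section CirculantTensor.

Variables (R : realType) (m n : nat).
Implicit Types (A : tensor R m.+1 n.+1) (s : m.-tuple 'I_n.+1).

(** Root and associated tensors only see row [ord0]; this induction carries facts about that row to
    all rows. *)
Lemma ordS_ind (P : 'I_n.+1 -> Prop) :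
  P ord0 -> (forall i, P i -> P (ordS i)) -> forall i, P i.
Proof.
move=> P0 PS [k]; elim: k => [|k IHk] ltk.
  by rewrite (_ : Ordinal ltk = ord0) //; apply: val_inj.
rewrite (_ : Ordinal ltk = ordS (Ordinal (ltnW ltk))); first exact/PS/IHk.
by apply: val_inj; rewrite /= modn_small.
Qed.

Lemma circulant_row_shift A i s :
  circulant A ->
  A (cons_tuple (ordS i) [tuple of map (@ordS _) s]) = A (cons_tuple i s).
Proof.
move=> cA; apply/esym/cA => l; rewrite !(tnth_nth ord0) /=.
case: l => [[|l]] ltl /=; first by rewrite modn_mod addn1.
by rewrite (nth_map ord0) ?size_tuple //= modn_mod addn1.
Qed.

Lemma map_ordS_bij : bijective (fun s => [tuple of map (@ordS _) s]).
Proof.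
exists (fun s => [tuple of map (@ord_pred _) s]) => s; apply: val_inj => /=.
  by rewrite (mapK (@ordSK _)).
by rewrite (mapK (@ord_predK _)).
Qed.

Lemma circulant_row_sum A :
  circulant A ->
  forall i, \sum_s A (cons_tuple i s) = native_eigenvalue0 A.
Proof.
move=> cA; apply: ordS_ind => // i <-.
rewrite (reindex _ (onW_bij _ map_ordS_bij)) /=.
by apply: eq_bigr => s _; apply: circulant_row_shift.
Qed.

(** Shifting all indices at once preserves being off the diagonal, so the sign known in row [ord0]
    travels down the rows. *)
Lemma circulant_offdiag_ge0 A :
  circulant A -> nonnegative_tensor (associated_tensor A) ->
  forall i s, s != nseq_tuple m i -> 0 <= A (cons_tuple i s).
Proof.
move=> cA A_ge0; apply: ordS_ind => [s s_neq0 | i IHi s].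
  by have := A_ge0 s; rewrite /associated_tensor (negbTE s_neq0).
(* Pull [s] back to [g s] in row [i]: were [g s] constantly [i], then [s] would be constantly
   [ordS i]. *)
have [g _ gK] := map_ordS_bij; rewrite -(gK s) circulant_row_shift // => s_neq.
apply: IHi; apply: contraNneq s_neq => ->.
by apply/eqP/val_inj; rewrite /= map_nseq.
Qed.

Lemma native_eigenvalue0_H_eigenvalue A :
  circulant A -> H_eigenvalue A (native_eigenvalue0 A).
Proof.
move=> cA; exists (const_mx 1) => [|i].
  by apply/eqP => /matrixP/(_ ord0 0)/eqP; rewrite !mxE oner_eq0.
rewrite mxE expr1n mulr1 -(circulant_row_sum cA i); apply: eq_bigr => s _.
by rewrite big1 ?mulr1 // => l _; rewrite mxE.
Qed.

Lemma circulant_nonneg_largest A :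
  circulant A -> nonnegative_tensor (associated_tensor A) ->
  largest_H_eigenvalue A (native_eigenvalue0 A).
Proof.
move=> cA A_ge0; split=> [|mu [x x_neq0 eig_x]].
  exact: native_eigenvalue0_H_eigenvalue.
pose i := [arg max_(k > ord0) `|x k 0|]%O.
have x_le k : `|x k 0| <= `|x i 0|.
  by rewrite /i; case: arg_maxP => // j _ /(_ k isT).
have xi_neq0 : x i 0 != 0.
  apply: contraNneq x_neq0 => xi0; apply/eqP/matrixP => k j.
  by rewrite mxE ord1; apply/eqP; rewrite -normr_le0 -(normr0 R) -xi0.
set y := x i 0 ^+ m.
(* The factor is [y * y] rather than [y] because [y] may be negative when [m] is odd. *)
have yy_gt0 : 0 < y * y by rewrite -expr2 exprn_even_gt0 //= expf_neq0.
rewrite -subr_ge0 -(pmulr_lge0 _ yy_gt0).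
have -> : (native_eigenvalue0 A - mu) * (y * y) =
    \sum_s A (cons_tuple i s) *
      (y * y - y * \prod_(l < m) x (tnth s l) 0).
  (* After splitting, the first sum is a row sum times [y * y], the second [y] times the left side
     of the eigenvalue equation at [i]. *)
  under eq_bigr do rewrite mulrBr [_ * (y * \prod_(_ < _) _)]mulrCA.
  by rewrite sumrB -mulr_suml -mulr_sumr eig_x circulant_row_sum // mulrBl
    [y * (mu * _)]mulrCA.
apply: sumr_ge0 => s _.
have [->|s_neq] := eqVneq s (nseq_tuple m i).
  under eq_bigr do rewrite tnth_nseq.
  by rewrite prodr_const card_ord subrr mulr0.
apply: mulr_ge0; first exact: circulant_offdiag_ge0.
(* Pass to absolute values and cancel the common [|y|]; the product is then bounded factor by factor
   by [|x i 0|]. *)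
rewrite subr_ge0 (le_trans (ler_norm _)) // -(gtr0_norm yy_gt0) !normrM.
apply: ler_wpM2l => //; rewrite normr_prod /y normrX -[m in leRHS]card_ord.
by rewrite -prodr_const; apply: ler_prod => l _; rewrite normr_ge0 x_le.
Qed.

Lemma H_eigenvalueN A mu :
  H_eigenvalue A mu -> H_eigenvalue (fun j => - A j) (- mu).
Proof.
case=> x x_neq0 eig_x; exists x => // i.
by rewrite mulNr -eig_x -sumrN; apply: eq_bigr => s _; rewrite mulNr.
Qed.

Lemma circulant_nonpos_smallest A :
  circulant A -> nonpositive_tensor (associated_tensor A) ->
  smallest_H_eigenvalue A (native_eigenvalue0 A).
Proof.
move=> cA A_le0; split=> [|mu /H_eigenvalueN eig_mu].
  exact: native_eigenvalue0_H_eigenvalue.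
have cN : circulant (fun j => - A j) by move=> j k /cA ->.
have N_ge0 : nonnegative_tensor (associated_tensor (fun j => - A j)).
  move=> s; have := A_le0 s; rewrite /associated_tensor /root_tensor.
  by case: ifP => // _; rewrite oppr_ge0.
have [_ /(_ _ eig_mu)] := circulant_nonneg_largest cN N_ge0.
by rewrite /native_eigenvalue0 sumrN lerN2.
Qed.

End CirculantTensor.

Theorem theorem2 (R : realType) (m n : nat)
    (hm : (2 <= m.+1)%N) (hn : (2 <= n.+1)%N)
    (A : tensor R m.+1 n.+1) (hA : circulant A) :
  (nonnegative_tensor (associated_tensor A) ->
     largest_H_eigenvalue A (native_eigenvalue0 A)) /\
  (nonpositive_tensor (associated_tensor A) ->
     smallest_H_eigenvalue A (native_eigenvalue0 A)).
Proof.
by split; [exact: circulant_nonneg_largest | exact: circulant_nonpos_smallest].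
Qed.
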